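(* Let $J:\mathfrak{su}(2)\to\mathfrak{su}(2)$ be an $\mathbb{R}$-linear map, identified with its matrix in the basis $(J_1,J_2,J_3)$. Then $J$ has zero torsion if and only if there exist $R\in SO(3)$ and $\xi^3_3\in\mathbb{R}$ such that $$R^{-1}JR=\begin{pmatrix}0&1&0\\-1&0&0\\0&0&\xi^3_3\end{pmatrix}.$$
   Context: $\mathfrak{su}(2)$ is the real Lie algebra with basis $(J_1,J_2,J_3)$ and brackets $[J_1,J_2]=J_3$, $[J_2,J_3]=J_1$, $[J_3,J_1]=J_2$. Linear maps are identified with their matrices in this basis (the $j$-th column gives the coordinates of the image of $J_j$). A linear map $J:\mathfrak{g}\to\mathfrak{g}$ on a real Lie algebra $\mathfrak{g}$ (not necessarily with $J^2=-1$) has zero torsion if $[JX,JY]-[X,Y]-J[JX,Y]-J[X,JY]=0$ for all $X,Y\in\mathfrak{g}$. *)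

(* Defs.v *)
(* MathComp world; the field of real numbers is an arbitrary R : realType. *)
From HB Require Import structures.
From mathcomp Require Import all_boot all_order all_algebra.
From mathcomp Require Import reals ring.

Set Implicit Arguments.
Unset Strict Implicit.
Unset Printing Implicit Defensive.

Import GRing.Theory.
Local Open Scope ring_scope.

HB.mixin Record Lmodule_isLieAlgebra (R : pzRingType) V
    of GRing.Lmodule R V := {
  lie : V -> V -> V;
  lieDl : forall (a : R) (x y z : V),
    lie (a *: x + y) z = a *: lie x z + lie y z;
  lieDr : forall (a : R) (x y z : V),
    lie x (a *: y + z) = a *: lie x y + lie x z;
  liexx : forall x : V, lie x x = 0;
  lie_jacobi : forall x y z : V,
    lie x (lie y z) + lie y (lie z x) + lie z (lie x y) = 0
}.

#[short(type="lieAlgType")]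
HB.structure Definition LieAlgebra (R : pzRingType) :=
  { V of GRing.Lmodule R V & Lmodule_isLieAlgebra R V }.

Definition zero_torsion (R : realType) (g : lieAlgType R)
    (J : {linear g -> g}) : Prop :=
  forall X Y : g,
    lie (J X) (J Y) - lie X Y - J (lie (J X) Y) - J (lie X (J Y)) = 0.

(* su(2), with X : su2 R the column of coordinates in (J_1, J_2, J_3). *)
Definition su2 (R : realType) : Type := 'cV[R]_3.

HB.instance Definition _ (R : realType) := GRing.Lmodule.on (su2 R).

(* Indices are shifted by one: su2_basis R 0, 1, 2 are J_1, J_2, J_3. *)
Definition su2_basis (R : realType) (j : 'I_3) : su2 R := delta_mx j 0.

(* Bilinear extension of [J_1, J_2] = J_3, [J_2, J_3] = J_1, [J_3, J_1] = J_2
   (see su2_lie_basis). The sums i + 1 and i + 2 are taken in 'I_3, that is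
   modulo 3. *)
Definition su2_lie (R : realType) (X Y : su2 R) : su2 R :=
  \col_(i < 3)
    (X (i + 1) 0 * Y (i + 2%:R) 0 - X (i + 2%:R) 0 * Y (i + 1) 0).

Section Su2Lie.
Variable R : realType.

Fact su2_lieDl (a : R) (x y z : su2 R) :
  su2_lie (a *: x + y) z = a *: su2_lie x z + su2_lie y z.
Proof. by apply/matrixP => i j; rewrite !mxE; ring. Qed.

Fact su2_lieDr (a : R) (x y z : su2 R) :
  su2_lie x (a *: y + z) = a *: su2_lie x y + su2_lie x z.
Proof. by apply/matrixP => i j; rewrite !mxE; ring. Qed.

Fact su2_liexx (x : su2 R) : su2_lie x x = 0.
Proof. by apply/matrixP => i j; rewrite !mxE; ring. Qed.

Fact su2_lie_jacobi (x y z : su2 R) :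
  su2_lie x (su2_lie y z) + su2_lie y (su2_lie z x)
    + su2_lie z (su2_lie x y) = 0.
Proof.
apply/matrixP => i j; rewrite !mxE.
have -> : i + 1 + 1 = i + 2%:R by rewrite -addrA.
have -> : i + 1 + 2%:R = i.
  by rewrite -addrA (_ : 1 + 2%:R = 0) ?addr0 //; apply/val_inj.
have -> : i + 2%:R + 1 = i.
  by rewrite -addrA (_ : 2%:R + 1 = 0) ?addr0 //; apply/val_inj.
have -> : i + 2%:R + 2%:R = i + 1.
  by rewrite -addrA (_ : 2%:R + 2%:R = 1) //; apply/val_inj.
ring.
Qed.

HB.instance Definition _ :=
  @Lmodule_isLieAlgebra.Build R (su2 R) (@su2_lie R)
    su2_lieDl su2_lieDr su2_liexx su2_lie_jacobi.

Fact su2_lie_basis :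
  [/\ lie (su2_basis R 0) (su2_basis R 1) = su2_basis R 2%:R,
      lie (su2_basis R 1) (su2_basis R 2%:R) = su2_basis R 0
    & lie (su2_basis R 2%:R) (su2_basis R 0) = su2_basis R 1].
Proof.
by split; apply/matrixP => -[[|[|[|]]] //= ?] j;
   rewrite !mxE (ord1 j) /= ?mulr0 ?mul0r ?mulr1 ?subr0 ?sub0r ?oppr0.
Qed.

End Su2Lie.

(* Column convention: column j holds the coordinates of the image of the j-th
   basis vector. *)
Definition su2_mx (R : realType) (J : {linear su2 R -> su2 R}) : 'M[R]_3 :=
  \matrix_(i < 3, j < 3) (J (su2_basis R j) : 'cV[R]_3) i 0.

Definition is_SO (R : realType) (n : nat) (A : 'M[R]_n) : Prop :=
  A^T *m A = 1%:M /\ \det A = 1.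

Definition mx3 (R : realType) (a b c d e f g h k : R) : 'M[R]_3 :=
  \matrix_(i < 3, j < 3)
    (nth [::] [:: [:: a; b; c]; [:: d; e; f]; [:: g; h; k]] i)`_j.

(* Main.v *)
(** In coordinates, with [A] the matrix of [J] and the bracket being the cross
    product, the torsion of [J] is [T A *m (X x Y)] for
    [T A = (A + A^T) A^T - tr A (A + A^T) + (s2 A - 1)], where [s2 A] is the sum
    of the principal 2x2 minors: this follows from
    [AX x AY = (adj A)^T (X x Y)], [AX x Y + X x AY = (tr A - A^T) (X x Y)] and
    Cayley-Hamilton. The condition [T A = 0] is invariant under orthogonal
    conjugation, so one may rotate the axis of the skew part of [A] to the third
    basis vector; the equation can then be solved by hand. *)
Require Import Defs.
From HB Require Import structures.
From mathcomp Require Import all_boot all_order all_algebra.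
From mathcomp Require Import reals.
From mathcomp Require Import ring lra.

Import Order.TTheory GRing.Theory Num.Theory.
Local Open Scope ring_scope.

(** * Arithmetic of 3x3 matrices given by their nine entries *)

Lemma mx3E (R : realType) (A : 'M[R]_3) :
  A = mx3 (A 0 0) (A 0 1) (A 0 2%:R) (A 1 0) (A 1 1) (A 1 2%:R)
          (A 2%:R 0) (A 2%:R 1) (A 2%:R 2%:R).
Proof.
by apply/matrixP => -[[|[|[|//]]] Hi] -[[|[|[|//]]] Hj]; rewrite mxE /=;
   congr (A _ _); apply/val_inj.
Qed.

Lemma mx3_inj (R : realType)
    (a b c d e f g h k a' b' c' d' e' f' g' h' k' : R) :
  mx3 a b c d e f g h k = mx3 a' b' c' d' e' f' g' h' k' ->
  [/\ [/\ a = a', b = b' & c = c'], [/\ d = d', e = e' & f = f']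
    & [/\ g = g', h = h' & k = k']].
Proof.
move/matrixP => E.
by split; split;
   [have := E 0 0 | have := E 0 1 | have := E 0 2%:R
   |have := E 1 0 | have := E 1 1 | have := E 1 2%:R
   |have := E 2%:R 0 | have := E 2%:R 1 | have := E 2%:R 2%:R]; rewrite !mxE.
Qed.

Section Mx3.
Variable R : realType.
Implicit Types a b c d e f g h k s : R.

Lemma tr_mx3 a b c d e f g h k :
  (mx3 a b c d e f g h k)^T = mx3 a d g b e h c f k.
Proof. by rewrite [LHS]mx3E !mxE. Qed.

Lemma add_mx3 a b c d e f g h k a' b' c' d' e' f' g' h' k' :
  mx3 a b c d e f g h k + mx3 a' b' c' d' e' f' g' h' k' =
  mx3 (a + a') (b + b') (c + c') (d + d') (e + e') (f + f')
      (g + g') (h + h') (k + k').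
Proof. by rewrite [LHS]mx3E !mxE. Qed.

Lemma opp_mx3 a b c d e f g h k :
  - mx3 a b c d e f g h k =
  mx3 (- a) (- b) (- c) (- d) (- e) (- f) (- g) (- h) (- k).
Proof. by rewrite [LHS]mx3E !mxE. Qed.

Lemma scale_mx3 s a b c d e f g h k :
  s *: mx3 a b c d e f g h k =
  mx3 (s * a) (s * b) (s * c) (s * d) (s * e) (s * f) (s * g) (s * h) (s * k).
Proof. by rewrite [LHS]mx3E !mxE. Qed.

Lemma scalar_mx3 s : s%:M = mx3 s 0 0 0 s 0 0 0 s.
Proof. by rewrite [LHS]mx3E !mxE /= ?mulr1n ?mulr0n. Qed.

Lemma zero_mx3 : 0 = mx3 0 0 0 0 0 0 0 0 0 :> 'M[R]_3.
Proof. by rewrite [LHS]mx3E !mxE. Qed.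

Lemma mul_mx3 a b c d e f g h k a' b' c' d' e' f' g' h' k' :
  mx3 a b c d e f g h k *m mx3 a' b' c' d' e' f' g' h' k' =
  mx3 (a * a' + b * d' + c * g') (a * b' + b * e' + c * h')
      (a * c' + b * f' + c * k')
      (d * a' + e * d' + f * g') (d * b' + e * e' + f * h')
      (d * c' + e * f' + f * k')
      (g * a' + h * d' + k * g') (g * b' + h * e' + k * h')
      (g * c' + h * f' + k * k').
Proof.
by rewrite [LHS]mx3E !mxE !big_ord_recr !big_ord0 /= !add0r !mxE.
Qed.

Lemma mxtrace_mx3 a b c d e f g h k : \tr (mx3 a b c d e f g h k) = a + e + k.
Proof. by rewrite /mxtrace !big_ord_recr big_ord0 /= add0r !mxE. Qed.

Lemma det_mx22 (A : 'M[R]_2) : \det A = A 0 0 * A 1 1 - A 0 1 * A 1 0.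
Proof.
rewrite (expand_det_row _ 0) !big_ord_recr big_ord0 /= add0r /cofactor.
rewrite !det_mx11 !mxE /= expr0 expr1 mul1r mulN1r mulrN.
by congr (A _ _ * A _ _ - A _ _ * A _ _); apply/val_inj.
Qed.

Lemma det_mx3 a b c d e f g h k :
  \det (mx3 a b c d e f g h k) =
  a * (e * k - f * h) - b * (d * k - f * g) + c * (d * h - e * g).
Proof.
rewrite (expand_det_row _ 0) !big_ord_recr big_ord0 /= add0r /cofactor.
rewrite !det_mx22 !mxE /=.
ring.
Qed.

End Mx3.

(** * The torsion matrix and its relation to the bracket *)

(** The halved difference of traces is [s2 A]; in this form it is visibly invariant under
    conjugation. *)
Definition torsion_mx {R : realType} {n : nat} (A : 'M[R]_n) : 'M[R]_n :=
  (A + A^T) *m A^T - \tr A *: (A + A^T)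
    + ((\tr A ^+ 2 - \tr (A *m A)) / 2 - 1)%:M.

Lemma torsion_mx_conj (R : realType) (n : nat) (Q A : 'M[R]_n) :
  Q^T *m Q = 1%:M -> torsion_mx (Q^T *m A *m Q) = Q^T *m torsion_mx A *m Q.
Proof.
move=> QTQ; have QQT : Q *m Q^T = 1%:M by apply: mulmx1C.
have conjM B C : Q^T *m B *m Q *m (Q^T *m C *m Q) = Q^T *m (B *m C) *m Q.
  by rewrite !mulmxA -(mulmxA _ Q) QQT mulmx1.
have trC B : \tr (Q^T *m B *m Q) = \tr B.
  by rewrite mxtrace_mulC mulmxA QQT mul1mx.
have conjT : (Q^T *m A *m Q)^T = Q^T *m A^T *m Q.
  by rewrite !trmx_mul trmxK mulmxA.
have conjS s : Q^T *m s%:M *m Q = s%:M.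
  by rewrite mul_mx_scalar -scalemxAl QTQ scalemx1.
rewrite /torsion_mx conjT conjM !trC -mulmxDl -mulmxDr conjM.
(* Naming the sum [S] keeps distributivity from splitting it. *)
move: (A + A^T) => S; rewrite mulmxDr mulmxDl conjS mulmxBr mulmxBl.
by rewrite -scalemxAr -scalemxAl.
Qed.

Lemma su2_mxE (R : realType) (J : {linear su2 R -> su2 R}) (X : su2 R) :
  J X = su2_mx J *m X :> 'cV[R]_3.
Proof.
have {1}-> : X = \sum_j X j 0 *: su2_basis R j.
  rewrite [LHS]matrix_sum_delta; apply: eq_bigr => j _.
  by rewrite big_ord1.
rewrite linear_sum; apply/matrixP => i k; rewrite (ord1 k) summxE mxE.
by apply: eq_bigr => j _; rewrite linearZ !mxE mulrC.
Qed.

Definition col3 {R : realType} (a b c : R) : 'cV[R]_3 :=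
  \col_(i < 3) [:: a; b; c]`_i.

Lemma col3E (R : realType) (X : 'cV[R]_3) :
  X = col3 (X 0 0) (X 1 0) (X 2%:R 0).
Proof.
by apply/matrixP => -[[|[|[|//]]] Hi] j; rewrite (ord1 j) mxE /=;
   congr (X _ _); apply/val_inj.
Qed.

Lemma lie_col3 (R : realType) (a b c a' b' c' : R) :
  lie (col3 a b c : su2 R) (col3 a' b' c' : su2 R) =
  col3 (b * c' - c * b') (c * a' - a * c') (a * b' - b * a').
Proof. by rewrite [LHS](@col3E R) !mxE. Qed.

Lemma mul_mx3_col3 (R : realType) (a b c d e f g h k x y z : R) :
  mx3 a b c d e f g h k *m col3 x y z =
  col3 (a * x + b * y + c * z) (d * x + e * y + f * z) (g * x + h * y + k * z).
Proof.
by rewrite [LHS]col3E !mxE !big_ord_recr !big_ord0 /= !add0r !mxE.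
Qed.

Lemma sub_col3 (R : realType) (a b c a' b' c' : R) :
  col3 a b c - col3 a' b' c' = col3 (a - a') (b - b') (c - c').
Proof. by rewrite [LHS]col3E !mxE. Qed.

Lemma torsion_mx3 (R : realType) (a b c d e f g h k : R) :
  torsion_mx (mx3 a b c d e f g h k) =
  let t := a + e + k in
  let s := a * e + a * k + e * k - b * d - c * g - f * h - 1 in
  mx3 ((a + a) * a + (b + d) * b + (c + g) * c - t * (a + a) + s)
      ((a + a) * d + (b + d) * e + (c + g) * f - t * (b + d))
      ((a + a) * g + (b + d) * h + (c + g) * k - t * (c + g))
      ((b + d) * a + (e + e) * b + (f + h) * c - t * (b + d))
      ((b + d) * d + (e + e) * e + (f + h) * f - t * (e + e) + s)
      ((b + d) * g + (e + e) * h + (f + h) * k - t * (f + h))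
      ((c + g) * a + (f + h) * b + (k + k) * c - t * (c + g))
      ((c + g) * d + (f + h) * e + (k + k) * f - t * (f + h))
      ((c + g) * g + (f + h) * h + (k + k) * k - t * (k + k) + s).
Proof.
rewrite /torsion_mx tr_mx3 add_mx3 !mul_mx3 !mxtrace_mx3 scalar_mx3 scale_mx3.
by rewrite opp_mx3 !add_mx3; congr mx3; field.
Qed.

(** Both sides are polynomials in the entries of the matrix and the coordinates of [X] and [Y], so
    the identity is checked coordinatewise. *)
Lemma torsionE (R : realType) (J : {linear su2 R -> su2 R}) (X Y : su2 R) :
  lie (J X) (J Y) - lie X Y - J (lie (J X) Y) - J (lie X (J Y)) =
  torsion_mx (su2_mx J) *m (lie X Y : 'cV[R]_3).
Proof.
rewrite !(su2_mxE _ J) [su2_mx J]mx3E (col3E _ X) (col3E _ Y).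
rewrite !(mul_mx3_col3, lie_col3) torsion_mx3 mul_mx3_col3 !sub_col3.
congr col3; ring.
Qed.

(** Each basis vector is a bracket of the two others, so a matrix that kills all brackets kills the
    basis. *)
Lemma zero_torsionE (R : realType) (J : {linear su2 R -> su2 R}) :
  zero_torsion J <-> torsion_mx (su2_mx J) = 0.
Proof.
split=> [TJ | T0 X Y]; last by rewrite torsionE T0 mul0mx.
have [L0 L1 L2] := su2_lie_basis R.
have colT (X Y : su2 R) : torsion_mx (su2_mx J) *m (lie X Y : 'cV[R]_3) = 0.
  by rewrite -torsionE.
suff T0 j : torsion_mx (su2_mx J) *m delta_mx j (0 : 'I_1) = 0.
  apply/matrixP => i j; have := T0 j.
  by rewrite -colE => /matrixP/(_ i 0); rewrite !mxE.
case: j => -[|[|[|//]]] Hj.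
- by have := colT (su2_basis R 1) (su2_basis R 2%:R); rewrite L1;
     congr (_ *m delta_mx _ _ = _); apply/val_inj.
- by have := colT (su2_basis R 2%:R) (su2_basis R 0); rewrite L2;
     congr (_ *m delta_mx _ _ = _); apply/val_inj.
- by have := colT (su2_basis R 0) (su2_basis R 1); rewrite L0;
     congr (_ *m delta_mx _ _ = _); apply/val_inj.
Qed.

(** * Rotating the axis of a skew matrix *)

(** This is Rodrigues' formula for the rotation taking the third basis vector [e] to
    [u = (x, y, z) / r] about the axis [e x u]; [r + z != 0] excludes [u = - e]. *)
Lemma is_SO_rot (R : realType) (r x y z : R) :
  r ^+ 2 = x ^+ 2 + y ^+ 2 + z ^+ 2 -> r != 0 -> r + z != 0 ->
  is_SO (mx3 (1 - x ^+ 2 / (r * (r + z))) (- (x * y) / (r * (r + z))) (x / r)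
             (- (x * y) / (r * (r + z))) (1 - y ^+ 2 / (r * (r + z))) (y / r)
             (- x / r) (- y / r) (z / r)).
Proof.
(* Solved for the monomial [x ^+ 2], the relation can serve [field] as a rewrite rule. *)
move=> r2 r0 rz0; have {r2} x2 : x ^+ 2 = r ^+ 2 - y ^+ 2 - z ^+ 2.
  by rewrite r2; ring.
split.
  rewrite tr_mx3 mul_mx3 scalar_mx3; congr mx3; field: x2; rewrite ?r0 ?rz0 //.
by rewrite det_mx3; field: x2; rewrite ?r0 ?rz0.
Qed.

(** The skew matrix is [v -> v x w] with [w = (x, y, z)]. A rotation [Q] sending the third basis
    vector to [w / r], with [r] the norm of [w], conjugates it to the cross product with
    [(0, 0, r)]. *)
Lemma skew_normal_form (R : realType) (x y z : R) :
  exists Q r, [/\ is_SO Q, 0 <= r &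
    Q^T *m mx3 0 z (- y) (- z) 0 x y (- x) 0 *m Q =
    mx3 0 r 0 (- r) 0 0 0 0 0].
Proof.
pose r := Num.sqrt (x ^+ 2 + y ^+ 2 + z ^+ 2).
have r2 : r ^+ 2 = x ^+ 2 + y ^+ 2 + z ^+ 2.
  by rewrite sqr_sqrtr // !addr_ge0 // sqr_ge0.
have [rz0|rz0] := eqVneq (r + z) 0.
  have zE : z = - r by lra.
  have xy0 : x ^+ 2 + y ^+ 2 = 0 by move: r2; rewrite zE sqrrN; lra.
  have [x0 y0] : x = 0 /\ y = 0.
    by move/eqP: xy0; rewrite paddr_eq0 ?sqr_ge0 // !sqrf_eq0 =>
       /andP[/eqP-> /eqP->].
  (* Here [w = (0, 0, - r)], possibly zero; a half-turn about the first axis reverses it. *)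
  exists (mx3 1 0 0 0 (-1) 0 0 0 (-1)), r; split; [split | exact: sqrtr_ge0 |].
  - by rewrite tr_mx3 mul_mx3 scalar_mx3; congr mx3; ring.
  - by rewrite det_mx3; ring.
  - by rewrite tr_mx3 !mul_mx3 x0 y0 zE; congr mx3; ring.
have r0 : r != 0.
  apply: contra_neq rz0 => r0; move: r2.
  rewrite r0 expr0n /= add0r => /esym/eqP.
  by rewrite paddr_eq0 ?addr_ge0 ?sqr_ge0 // !sqrf_eq0 => /andP[_ /eqP->].
eexists; exists r.
split; [exact: (is_SO_rot _ r x y z r2 r0 rz0) | exact: sqrtr_ge0 |].
have {r2} x2 : x ^+ 2 = r ^+ 2 - y ^+ 2 - z ^+ 2 by rewrite r2; ring.
rewrite tr_mx3 !mul_mx3; congr mx3; field: x2; rewrite ?r0 ?rz0 //.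
Qed.

(** * Solving the torsion equation *)

(** For symmetric [A], [T A = 2 adj A - (s2 A + 1)]. If it vanishes, taking traces gives
    [s2 A = -3], hence [adj A = -1] and [(det A)^2 = det (adj A) = -1], impossible over the
    reals. *)
Lemma sym_torsion_mx_neq0 (R : realType) (a b c e f k : R) :
  torsion_mx (mx3 a b c b e f c f k) <> 0.
Proof.
rewrite torsion_mx3 zero_mx3 /=.
move=> /mx3_inj[[E00 E01 E02] [E10 E11 E12] [E20 E21 E22]].
(* The equations say that the adjugate is [-1], so the matrix is scalar. *)
have m1 : a * e - b ^+ 2 = -1 by lra.
have m2 : a * k - c ^+ 2 = -1 by lra.
have m3 : e * k - f ^+ 2 = -1 by lra.
have c1 : c * f = k * b by lra.
have c2 : b * f = e * c by lra.
have c3 : b * c = a * f by lra.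
(* By [c3] and [c1], [b * c ^+ 2 = a * c * f = a * b * k], so [m2] times [b] reads [0 = - b]. The
   next two cases are similar. *)
have b0 : b = 0.
  have := congr1 ( *%R b) m2.
  by have := congr1 ( *%R c) c3; have := congr1 ( *%R a) c1; lra.
have c0 : c = 0.
  have := congr1 ( *%R c) m1.
  by have := congr1 ( *%R b) c3; have := congr1 ( *%R a) c2; lra.
have f0 : f = 0.
  have := congr1 ( *%R f) m1.
  by have := congr1 ( *%R e) c3; have := congr1 ( *%R b) c2; lra.
subst b c f.
have : (a * e * k) ^+ 2 = -1.
  have -> : (a * e * k) ^+ 2 = (a * e) * (a * k) * (e * k) by ring.
  have -> : a * e = -1 by lra.
  have -> : a * k = -1 by lra.
  have -> : e * k = -1 by lra.
  by ring.
by have := sqr_ge0 (a * e * k); lra.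
Qed.

(** With [P] and [K] the symmetric and skew parts of the matrix, the skew part of the equation is
    [P K + K P = 0], that is [r c = r f = r (a + e) = 0]. The symmetric part then settles the
    rest. *)
Lemma torsion_mx_axis (R : realType) (a b c e f k r : R) :
  torsion_mx (mx3 a (b + r) c (b - r) e f c f k) = 0 ->
  [/\ a = 0, b = 0, c = 0, e = 0 & f = 0] /\ r ^+ 2 = 1.
Proof.
have [-> | r0] := eqVneq r 0.
  by rewrite addr0 subr0 => /sym_torsion_mx_neq0.
rewrite torsion_mx3 zero_mx3 /=.
move=> /mx3_inj[[E00 E01 E02] [E10 E11 E12] [E20 E21 E22]].
have c0 : c = 0 by apply: (mulfI r0); lra.
have f0 : f = 0 by apply: (mulfI r0); lra.
have ae : e = - a by apply: (mulfI r0); lra.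
subst c f e.
(* The sum of the first two diagonal equations minus twice the third is
   [4 (a ^+ 2 + b ^+ 2) = 0]. *)
have ab : a ^+ 2 + b ^+ 2 = 0 by lra.
have [a0 b0] : a = 0 /\ b = 0.
  by move/eqP: ab; rewrite paddr_eq0 ?sqr_ge0 // !sqrf_eq0 =>
     /andP[/eqP-> /eqP->].
by subst a b; split; [split | ]; lra.
Qed.

Lemma torsion_mx_normal_form (R : realType) (k : R) :
  torsion_mx (mx3 0 1 0 (-1) 0 0 0 0 k) = 0.
Proof.
rewrite torsion_mx3 zero_mx3 /=.
by congr mx3; ring.
Qed.

Theorem lemma2 (R : realType) (J : {linear su2 R -> su2 R}) :
  zero_torsion J <->
  exists (Q : 'M[R]_3) (xi33 : R),
    is_SO Q /\
    invmx Q *m su2_mx J *m Q = mx3   0   1    0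
                                   (-1)  0    0
                                     0   0  xi33.
Proof.
rewrite zero_torsionE; move: (su2_mx J) => A.
have invT (Q : 'M[R]_3) : is_SO Q -> invmx Q = Q^T.
  case=> QTQ _; have [_ Qu] := mulmx1_unit QTQ.
  by rewrite -[LHS]mul1mx -QTQ mulmxK.
split=> [TA | [Q [k [QSO QAQ]]]]; last first.
  have TQ : Q^T *m torsion_mx A *m Q = 0.
    by rewrite -torsion_mx_conj ?QSO.1 // -invT // QAQ torsion_mx_normal_form.
  have QQT : Q *m Q^T = 1%:M by apply: mulmx1C; case: QSO.
  have /(congr1 (fun M => Q *m M *m Q^T)) := TQ.
  by rewrite !mulmxA QQT mul1mx -mulmxA QQT mulmx1 mulmx0 mul0mx.
(* These are the axis coordinates of [A - A^T], which is twice the skew part of [A]; hence the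
   [r / 2] below. *)
pose x := A 1 2%:R - A 2%:R 1; pose y := A 2%:R 0 - A 0 2%:R.
pose z := A 0 1 - A 1 0.
have [Q [r [QSO r_ge0 KQ]]] := skew_normal_form R x y z.
pose B := Q^T *m A *m Q.
have BBT : B - B^T = mx3 0 r 0 (- r) 0 0 0 0 0.
  have -> : B^T = Q^T *m A^T *m Q by rewrite !trmx_mul trmxK mulmxA.
  rewrite -KQ -mulmxBl -mulmxBr; congr (_ *m _ *m _).
  by rewrite [LHS]mx3E !mxE; congr mx3; rewrite /x /y /z; ring.
have TB : torsion_mx B = 0.
  by rewrite torsion_mx_conj ?QSO.1 // TA mulmx0 mul0mx.
exists Q, (B 2%:R 2%:R); split=> //; rewrite invT // -/B.
move: TB BBT; rewrite [B]mx3E.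
move: (B 0 0) (B 0 1) (B 0 2%:R) (B 1 0) (B 1 1) (B 1 2%:R)
  (B 2%:R 0) (B 2%:R 1) (B 2%:R 2%:R) => a b c d e f g h k.
rewrite tr_mx3 opp_mx3 add_mx3 !mxE /= => TB.
move=> /mx3_inj[[_ bd cg] [_ _ fh] _].
have [gE hE] : g = c /\ h = f by split; lra.
have BE : mx3 a b c d e f g h k =
    mx3 a ((b + d) / 2 + r / 2) c ((b + d) / 2 - r / 2) e f c f k.
  by congr mx3; lra.
move: TB; rewrite BE => /torsion_mx_axis[[-> bd0 -> -> ->] /eqP r2].
(* The equation only gives [(r / 2) ^+ 2 = 1]; the sign comes from [0 <= r]. *)
have r1 : r / 2 = 1.
  by apply/eqP; rewrite -[_ == 1](@eqrXn2 _ 2) ?expr1n // divr_ge0.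
by congr mx3; lra.
Qed.
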